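(* Let $n\ge 1$, let $f\in\mathbb{Z}[x_1,\dots,x_n]$ be a polynomial of degree $d>1$, let $f_d$ be its homogeneous part of degree $d$, and let $s$ be the dimension of the critical locus of $f_d$ in $\mathbb{C}^n$. Suppose that for every $\varepsilon>0$ there is a constant $c=c(f,\varepsilon)$ such that $E_f(N,\xi)\le c\,N^{-\frac{n-s}{d}+\varepsilon}$ for all integers $N\ge 1$ and all complex primitive $N$-th roots of unity $\xi$. Let $p$ be a prime number, let $T_0\in\mathbb{C}$ be a pole of the rational function $P_{f,p}(T)$, and let $t_0$ be the real part of a complex number $s_0$ with $p^{-s_0}=T_0$. If $t_0>-(n-s)/d$, then $t_0=-1$, and hence $t_0$ is a zero of the Bernstein-Sato polynomial of $f$.
   Context: For an integer $N\ge 1$ and a complex primitive $N$-th root of unity $\xi$, put $$E_f(N,\xi):=\left|\frac{1}{N^n}\sum_{x\in(\mathbb{Z}/N\mathbb{Z})^n}\xi^{f(x)}\right|.$$ The critical locus of $f_d$ is the set of $x\in\mathbb{C}^n$ at which all partial derivatives $\partial f_d/\partial x_i$ vanish. For a prime $p$ and an integer $m\ge 0$ let $a_{p,m}$ be the number of solutions in $(\mathbb{Z}/p^m\mathbb{Z})^n$ of $f(x)\equiv 0\bmod p^m$, and put $$P_{f,p}(T):=\sum_{m\ge 0}\frac{a_{p,m}}{p^{mn}}T^m\in\mathbb{Q}[[T]].$$ By a theorem of Igusa, $P_{f,p}(T)$ is a rational function of $T$; its poles are those of this rational function. The Bernstein-Sato polynomial $b_f$ of $f$ is the monic polynomial $b(\sigma)\in\mathbb{C}[\sigma]$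 of least degree for which there is a differential operator $D\in \mathbb{C}[x_1,\dots,x_n,\sigma]\langle\partial_{x_1},\dots,\partial_{x_n}\rangle$ with $D\cdot f^{\sigma+1}=b(\sigma)f^{\sigma}$. *)

(* Defs.v *)
From HB Require Import structures.
From mathcomp Require Import all_boot all_order all_algebra.
From mathcomp Require Import fraction complex.
From mathcomp Require Import all_classical all_reals all_analysis.
(* The notations of mpoly clash with those of mathcomp-analysis. *)
From mathcomp Require Import -(notations) mpoly.

Set Implicit Arguments.
Unset Strict Implicit.
Unset Printing Implicit Defensive.

Import Order.TTheory GRing.Theory Num.Theory.

Local Open Scope classical_set_scope.
Local Open Scope ring_scope.
Local Open Scope complex_scope.

Notation "{ 'mpoly' T [ n ] }" := (mpoly.mpoly n T)
  (T at level 2, format "{ 'mpoly'  T [ n ] }") : type_scope.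
Notation "p .@[ x ]" := (@meval _ _ x p) : ring_scope.

Definition expC (R : realType) (z : R[i]) : R[i] :=
  (expR (complex.Re z))%:C * (cos (complex.Im z) +i* sin (complex.Im z)).

(* [cpow a z] is a ^ z = exp (z ln a), for a > 0 real. *)
Definition cpow (R : realType) (a : R) (z : R[i]) : R[i] :=
  expC (z * (ln a)%:C).

Section IntegerPolynomials.
Variable n : nat.
Implicit Type f : {mpoly int[n]}.

(* (Z/NZ)^n is represented by residues in [0, N); the type 'Z_N would be wrong
   for N = 1. *)
Definition eval_res f (N : nat) (x : {ffun 'I_n -> 'I_N}) : int :=
  f.@[fun i => (x i : nat)%:Z].

Definition expsum (R : realType) f (N : nat) (xi : R[i]) : R :=
  Normc.normc ((N%:R ^+ n)^-1 * \sum_(x : {ffun 'I_n -> 'I_N}) xi ^ eval_res f x).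

Definition nb_sol f (p m : nat) : nat :=
  #|[pred x : {ffun 'I_n -> 'I_(p ^ m)} |
      (Posz (p ^ m) %| eval_res f x)%Z]|.

Definition poincare f (p m : nat) : rat := (nb_sol f p m)%:R / (p ^ (m * n))%:R.

Definition mpolyZC (R : realType) f : {mpoly R[i][n]} :=
  map_mpoly (intr : int -> R[i]) f.

End IntegerPolynomials.

(* A formal power series over F is given by its sequence of coefficients. *)
Definition is_expansion (F : fieldType) (A B : {poly F}) (P : nat -> F) : Prop :=
  B != 0 /\ forall k : nat, \sum_(i < k.+1) B`_i * P (k - i)%N = A`_k.

(* T0 is a pole of the rational function A / B, in lowest terms, of which P is
   the expansion. *)
Definition is_pole (R : realType) (P : nat -> rat) (T0 : R[i]) : Prop :=
  exists A B : {poly rat},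
    [/\ is_expansion A B P, coprimep A B & root (map_poly ratr B) T0].

Section Dimension.
Variables (K : fieldType) (n : nat).
Implicit Types V Z : set ('I_n -> K).

Definition zero_locus (S : set {mpoly K[n]}) : set ('I_n -> K) :=
  [set x | forall g, S g -> g.@[x] = 0].

Definition zariski_closed Z : Prop := exists S, Z = zero_locus S.

Definition zariski_irreducible Z : Prop :=
  Z !=set0 /\
  forall Z1 Z2, zariski_closed Z1 -> zariski_closed Z2 ->
    Z `<=` Z1 `|` Z2 -> Z `<=` Z1 \/ Z `<=` Z2.

Definition irred_chain V (k : nat) (c : nat -> set ('I_n -> K)) : Prop :=
  (forall i, (i <= k)%N ->
     [/\ zariski_closed (c i), zariski_irreducible (c i) & c i `<=` V]) /\
  (forall i, (i < k)%N -> c i `<` c i.+1).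

(* Krull dimension of a nonempty algebraic set *)
Definition has_dim V (k : nat) : Prop :=
  (exists c, irred_chain V k c) /\
  (forall l c, irred_chain V l c -> (l <= k)%N).

Definition critical_locus (g : {mpoly K[n]}) : set ('I_n -> K) :=
  [set x | forall i : 'I_n, (mderiv i g).@[x] = 0].

End Dimension.

Section BernsteinSato.
Variables (K : fieldType) (n : nat) (f : {mpoly K[n]}).

(* K[sigma][x_1, .., x_n] *)
Local Notation A := {mpoly {poly K}[n]}.

Definition liftA : A := map_mpoly polyC f.
Definition cstA (b : {poly K}) : A := mpolyC n b.

(* A pair (g, k) stands for the element g f^(sigma - k) of the module
   K[x, sigma, 1/f] f^sigma, on which
   d_i (g f^(sigma - k)) =
     (f d_i g + (sigma - k) g d_i f) f^(sigma - k - 1). *)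
Definition fpow_deriv (i : 'I_n) (u : A * nat) : A * nat :=
  (liftA * mderiv i u.1
     + cstA ('X - (u.2%:R)%:P) * u.1 * mderiv i liftA,
   u.2.+1).

Definition fpow_derivm (a : multinom n) (u : A * nat) : A * nat :=
  foldr (fun i => iter (a i) (fpow_deriv i)) u (enum 'I_n).

(* The coefficient g / f^k of f^sigma in the element (g, k). *)
Definition fpow_coef (u : A * nat) : {fraction A} :=
  FracField.tofrac u.1 / FracField.tofrac liftA ^+ u.2.

(* A differential operator is written uniquely as a sum of terms
   D_a(x, sigma) d^a with a a multi-index; it is encoded as the polynomial
   in n further variables with coefficients D_a. [weyl_act D u] is the
   coefficient of f^sigma in D u. *)
Definition weyl_act (D : {mpoly A[n]}) (u : A * nat) : {fraction A} :=
  \sum_(a <- msupp D)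
     FracField.tofrac (mcoeff a D) * fpow_coef (fpow_derivm a u).

(* The pair (f, 0) is f^(sigma + 1). *)
Definition bs_equation (D : {mpoly A[n]}) (b : {poly K}) : Prop :=
  weyl_act D (liftA, 0%N) = FracField.tofrac (cstA b).

Definition is_bernstein_sato (b : {poly K}) : Prop :=
  [/\ b \is monic, exists D, bs_equation D b &
      forall b' : {poly K}, b' \is monic -> (exists D, bs_equation D b') ->
        (size b <= size b')%N].

End BernsteinSato.

(* Main.v *)
(** Put [u m = a_{p,m} / p^(mn)]. Orthogonality of the characters of Z/p^m
    expresses [p^m u m] as the sum of the normalized exponential sums over all
    [p^m]-th roots of unity; those over non-primitive roots add up to
    [p^(m-1) u (m-1)]. Hence [u m - u (m-1) / p], the coefficient of [T^m] in
    [(1 - T/p) P(T)], is [p^(-m)] times a sum of at most [p^m] sums over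
    primitive roots, and the hypothesis makes it [O(p^(m(-(n-s)/d + eps)))].
    So [(1 - T/p) P(T)] has no pole in [|T| < p^((n-s)/d)], and a pole [T0] of
    [P] there can only be [p]. Finally -1 is a root of the Bernstein-Sato
    polynomial of every nonconstant [f]: setting [sigma = -1] in
    [D f^(sigma+1) = b(sigma) f^sigma] shows that [b(-1) / f] is a
    polynomial. *)

Require Import Defs.
From HB Require Import structures.
From mathcomp Require Import all_boot all_order all_algebra.
From mathcomp Require Import fraction complex.
From mathcomp Require Import all_classical all_reals all_analysis.
From mathcomp Require Import -(notations) mpoly.
From mathcomp Require Import cyclic separable cyclotomic ring zify.

Import Order.TTheory GRing.Theory Num.Theory.

Local Open Scope classical_set_scope.
Local Open Scope ring_scope.
Local Open Scope complex_scope.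

Set Implicit Arguments.
Unset Strict Implicit.
Unset Printing Implicit Defensive.

(** * Orthogonality of the characters of Z/N *)

Section RootsOfUnity.
Variable C : numClosedFieldType.

Lemma prim_root_exists N : (0 < N)%N -> exists z : C, N.-primitive_root z.
Proof.
move=> N_gt0; pose P : {poly C} := 'X^N - 1.
have [r Dr] := closed_field_poly_normal P.
rewrite (monicP _) ?monicXnsubC // scale1r in Dr.
have rN1 : all N.-unity_root r by apply/allP => z; rewrite -root_prod_XsubC -Dr.
have sz_r : (N <= size r)%N.
  by rewrite -ltnS -(size_prod_XsubC r id) -Dr size_XnsubC.
have [|z _ z_prim] := hasP (has_prim_root N_gt0 rN1 _ sz_r); last by exists z.
by rewrite -separable_prod_XsubC -Dr separable_Xn_sub_1 // pnatr_eq0 -lt0n.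
Qed.

Lemma prim_root_exprz_eq1 (N : nat) (z : C) (y : int) :
  N.-primitive_root z -> (z ^ y == 1) = (N%:Z %| y)%Z.
Proof.
move=> z_prim; rewrite dvdzE absz_nat (prim_order_dvd z_prim).
by case: y => y //; rewrite NegzE abszN absz_nat -exprnN invr_eq1.
Qed.

Lemma sum_prim_root (N : nat) (z : C) (y : int) : N.-primitive_root z ->
  \sum_(k < N) (z ^+ k) ^ y = if (N%:Z %| y)%Z then N%:R else 0.
Proof.
move=> z_prim.
have zk (k : nat) : (z ^+ k) ^ y = (z ^ y) ^+ k.
  by rewrite !exprnP !exprz_exp mulrC.
rewrite (eq_bigr _ (fun (k : 'I_N) _ => zk k)) -(prim_root_exprz_eq1 y z_prim).
have [->|zy] := eqVneq.
  by rewrite (eq_bigr (fun=> 1)) ?sumr_const ?card_ord // => k _; rewrite expr1n.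
(* Geometric sum: its product with z^y - 1 is z^(yN) - 1 = 0. *)
apply/eqP; have := subrX1 (z ^ y) N.
rewrite -zk (prim_expr_order z_prim) exp1rz subrr => /esym/eqP.
by rewrite mulf_eq0 subr_eq0 (negPf zy).
Qed.

End RootsOfUnity.

(** * Counting solutions of a congruence at a finer modulus *)

Section Counting.
Variables (n : nat) (f : {mpoly int[n]}).

Lemma meval_eqmod (M : int) (x y : 'I_n -> int) :
  (forall i, (M %| x i - y i)%Z) -> (M %| f.@[x] - f.@[y])%Z.
Proof.
move=> xy; pose E a b := (M %| a - b)%Z.
have EM a a' b b' : E a b -> E a' b' -> E (a * a') (b * b').
  rewrite /E => ab ab'; have -> : a * a' - b * b' = (a - b) * a' + b * (a' - b') by ring.
  by apply: rpredD; [apply: dvdz_mulr | apply: dvdz_mull].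
have Erefl a : E a a by rewrite /E subrr dvdz0.
rewrite -/(E _ _) !mevalE; apply: (big_ind2 E) => [|a b a' b' ab ab'|m _]; first exact: Erefl.
  by rewrite /E opprD addrACA rpredD.
apply: (EM _ _ _ _ (Erefl _)); apply: (big_ind2 E) => [|a b a' b'|i _]; [exact: Erefl|exact: EM|].
by elim: (m i) => // k IH; rewrite !exprS; exact: (EM _ _ _ _ (xy i) IH).
Qed.

Lemma card_mod_eq (M p : nat) (y : 'I_M) :
  #|[pred k : 'I_(p * M) | (k %% M)%N == y]| = p.
Proof.
have M_gt0 : (0 < M)%N by apply: leq_ltn_trans (ltn_ord y).
have lift_lt (j : 'I_p) : (j * M + y < p * M)%N.
  by have := ltn_ord j; have := ltn_ord y; nia.
pose g j := Ordinal (lift_lt j).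
have g_inj : injective g.
  by move=> i j [] /eqP; rewrite eqn_add2r eqn_pmul2r // => /eqP/val_inj.
rewrite -[RHS](card_ord p) -(card_codom g_inj); apply: eq_card => k.
rewrite inE; apply/eqP/codomP => [ky|[j ->]]; last first.
  by rewrite /= modnMDl modn_small.
have kM : (k %/ M < p)%N by rewrite ltn_divLR.
by exists (Ordinal kM); apply: val_inj; rewrite /= -ky -divn_eq.
Qed.

(** Whether f vanishes modulo M depends only on x modulo M, and each point modulo M has p^n lifts
    modulo pM. *)
Lemma card_lift_sol (M p : nat) : (0 < M)%N ->
  #|[pred x : {ffun 'I_n -> 'I_(p * M)} | (M%:Z %| eval_res f x)%Z]| =
  (p ^ n * #|[pred x : {ffun 'I_n -> 'I_M} | (M%:Z %| eval_res f x)%Z]|)%N.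
Proof.
move=> M_gt0.
pose red (x : {ffun 'I_n -> 'I_(p * M)}) : {ffun 'I_n -> 'I_M} :=
  [ffun i => Ordinal (ltn_pmod (x i) M_gt0)].
have red_sol x : (M%:Z %| eval_res f x)%Z = (M%:Z %| eval_res f (red x))%Z.
  have D : (M%:Z %| eval_res f x - eval_res f (red x))%Z.
    apply: meval_eqmod => i; rewrite ffunE /= -eqz_mod_dvd !modz_nat.
    by rewrite modn_mod.
  by rewrite -[eval_res f x](subrK (eval_res f (red x))) rpredDl.
rewrite -sum1_card (partition_big red (fun y => (M%:Z %| eval_res f y)%Z)) /=; last first.
  by move=> x; rewrite inE red_sol.
rewrite [RHS]mulnC -sum_nat_const; apply: eq_big => [y|y ysol]; first by rewrite inE.
rewrite sum1_card.
(* The fibre of [red] over y is a product of n sets of p residues each. *)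
transitivity #|family (fun i : 'I_n => [pred k : 'I_(p * M) | (k %% M)%N == y i])|.
  apply: eq_card => x; rewrite !inE; apply/andP/forallP => [[_ /eqP <-] i|xy].
    by rewrite inE ffunE.
  have redx : red x = y by apply/ffunP => i; rewrite ffunE; apply/val_inj/eqP/xy.
  by rewrite inE red_sol redx.
rewrite card_family foldrE big_image /=.
by under eq_bigr => i _ do rewrite card_mod_eq; rewrite prod_nat_const card_ord.
Qed.

End Counting.

(** * Estimates for truncated power series *)

Section TruncatedSeries.
Variable F : numFieldType.

(* If G is the truncation of g at order K, then h - B G takes the value h(T0)
   at T0 and has no coefficient below order K. *)
Lemma convolution_horner_le (B h : {poly F}) (g : nat -> F) (c r T0 : F) :
  (forall k, \sum_(i < k.+1) B`_i * g (k - i)%N = h`_k) ->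
  0 < c -> 0 < r -> `|T0| * r <= 1 -> (forall k, `|g k| <= c * r ^+ k) -> root B T0 ->
  exists2 M, 0 <= M &
    forall K, (size h <= K)%N -> `|h.[T0]| <= M * (`|T0| * r) ^+ K.
Proof.
move=> Bg c_gt0 r_gt0 q_le1 g_le B_T0; set q := `|T0| * r in q_le1 *.
have q_ge0 : 0 <= q by rewrite mulr_ge0 // ltW.
(* Chosen so that the coefficients of B G are at most c b r^k: shifting the index by i costs
   r^-i. *)
pose b := \sum_(i < size B) `|B`_i| * r ^- i.
have b_ge0 : 0 <= b.
  by apply: sumr_ge0 => i _; rewrite mulr_ge0 // invr_ge0 exprn_ge0 // ltW.
exists ((size B)%:R * (c * b)) => [|K hK].
  by rewrite !mulr_ge0 // ltW.
pose G := \poly_(k < K) g k.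
have G_le k : `|G`_k| <= c * r ^+ k.
  by rewrite coef_poly; case: ifP => // _; rewrite normr0 mulr_ge0 ?exprn_ge0 ?ltW.
have BG_low k : (k < K)%N -> (B * G)`_k = h`_k.
  move=> kK; rewrite coefM -Bg; apply: eq_bigr => i _.
  by rewrite coef_poly (leq_ltn_trans (leq_subr _ _) kK).
have BG_le k : `|(B * G)`_k| <= c * b * r ^+ k.
  rewrite coefM (le_trans (ler_norm_sum _ _ _)) //.
  have term i : (i <= k)%N -> `|B`_i * G`_(k - i)| <= c * r ^+ k * (`|B`_i| * r ^- i).
    move=> ik; rewrite normrM mulrCA ler_wpM2l // (le_trans (G_le _)) //.
    by rewrite expfB_cond ?mulrA // (gt_eqF r_gt0).
  apply: (@le_trans _ _ (\sum_(i < k.+1) c * r ^+ k * (`|B`_i| * r ^- i))).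
    by apply: ler_sum => i _; apply: term; rewrite -ltnS.
  rewrite -mulr_sumr mulrAC ler_wpM2r ?exprn_ge0 ?(ltW r_gt0) //.
  rewrite ler_wpM2l ?(ltW c_gt0) // /b.
  rewrite -!(big_mkord predT (fun i => `|B`_i| * r ^- i)).
  have nn i : 0 <= `|B`_i| * r ^- i by rewrite mulr_ge0 // invr_ge0 exprn_ge0 // ltW.
  (* Either the sum [b] has further nonnegative terms, or the terms beyond [size B] vanish. *)
  have [kB|Bk] := leqP k.+1 (size B).
    by rewrite (big_cat_nat (leq0n _) kB) //= lerDl sumr_ge0.
  rewrite (big_cat_nat (leq0n _) (ltnW Bk)) //= gerDl.
  rewrite big_nat_cond [leLHS]big1 //.
  by move=> i /andP[/andP[Bi _] _]; rewrite nth_default // normr0 mul0r.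
have -> : h.[T0] = (h - B * G).[T0].
  by rewrite hornerD hornerN hornerM (rootP B_T0) mul0r subr0.
have szD : (size (h - B * G)%R <= K + size B)%N.
  rewrite (leq_trans (size_polyD _ _)) // size_polyN geq_max (leq_trans hK) ?leq_addr //=.
  rewrite (leq_trans (size_polyMleq _ _)) // addnC.
  by rewrite (leq_trans (leq_pred _)) // leq_add2r size_poly.
(* Only the [size B] orders K + i are left, and q^(K+i) <= q^K because q <= 1. *)
rewrite (horner_coef_wide _ szD) big_split_ord /= big1 ?add0r => [|i _]; last first.
  by rewrite coefB BG_low // subrr mul0r.
rewrite (le_trans (ler_norm_sum _ _ _)) //.
apply: (@le_trans _ _ (\sum_(i < size B) c * b * q ^+ K)); last first.
  by rewrite sumr_const card_ord -[leLHS]mulr_natl !mulrA.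
apply: ler_sum => i _; rewrite coefB nth_default ?sub0r; last first.
  by rewrite (leq_trans hK) ?leq_addr.
rewrite normrM normrN normrX.
apply: (@le_trans _ _ (c * b * r ^+ (K + i) * `|T0| ^+ (K + i))).
  by rewrite ler_wpM2r ?exprn_ge0.
rewrite -mulrA -exprMn [r * _]mulrC -/q ler_wpM2l ?mulr_ge0 ?(ltW c_gt0) //.
by rewrite exprD ler_piMr ?exprn_ge0 // exprn_ile1.
Qed.

End TruncatedSeries.

(** * Passage to the limit in the disc of radius 1/r *)

Section ComplexSeries.
Import numFieldNormedType.Exports.
Variable R : realType.

Lemma normr_complexE (z : R[i]) : `|z| = (Normc.normc z)%:C.
Proof. by []. Qed.

Lemma normc_ge0 (z : R[i]) : 0 <= Normc.normc z.
Proof. by case: z => a b; exact: sqrtr_ge0. Qed.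

Lemma le0_geometric (x M q : R) (K0 : nat) : 0 <= q < 1 ->
  (forall K, (K0 <= K)%N -> x <= M * q ^+ K) -> x <= 0.
Proof.
move=> /andP[q_ge0 q_lt1] xM.
have /cvg_expr qcvg : `|q| < 1 by rewrite ger0_norm.
have Mcvg : (fun K => M * q ^+ K) @ \oo --> M * 0 by apply: cvgMr.
rewrite -(mulr0 M) -(cvg_lim _ Mcvg) //; apply: limr_ge; first by apply/cvg_ex; exists (M * 0).
by exists K0.
Qed.

(** Formally h = B g, and g converges at T0. The truncation bound replaces the summation of g:
    |h(T0)| <= M q^K for all large K, with q < 1. *)
Lemma convolution_root (B h : {poly R[i]}) (g : nat -> R[i]) (c r : R) (T0 : R[i]) :
  (forall k, \sum_(i < k.+1) B`_i * g (k - i)%N = h`_k) ->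
  0 < r -> Normc.normc T0 * r < 1 ->
  (forall k, Normc.normc (g k.+1) <= c * r ^+ k.+1) -> root B T0 -> root h T0.
Proof.
move=> Bg r_gt0 q_lt1 g_le B_T0.
(* [c'] also covers [g 0], which the hypothesis leaves free; the 1 keeps it positive. *)
pose c' := Num.max (Num.max c (Normc.normc (g 0%N))) 1.
have c'_gt0 : 0 < c' by rewrite lt_max ltr01 orbT.
have g_le' k : `|g k| <= c'%:C * r%:C ^+ k.
  rewrite normr_complexE -rmorphXn -rmorphM lecR; case: k => [|k].
    by rewrite expr0 mulr1 !le_max lexx orbT.
  by rewrite (le_trans (g_le k)) // ler_wpM2r ?exprn_ge0 ?(ltW r_gt0) // !le_max lexx.
have [|||M M_ge0 hM] := convolution_horner_le Bg _ _ _ g_le' B_T0.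
- by rewrite ltcR.
- by rewrite ltcR.
- by rewrite normr_complexE -rmorphM lecR ltW.
(* [M] lies in R[i]; being nonnegative it is real, so the limit can be taken in R. *)
have /complex_realP[M' ME] : M \is Num.real by exact: ger0_real.
rewrite rootE -normr_eq0 normr_complexE; apply/eqP; congr (_%:C).
apply/eqP; rewrite eq_le normc_ge0 andbT.
apply: (@le0_geometric _ M' (Normc.normc T0 * r) (size h)).
  by rewrite q_lt1 andbT mulr_ge0 ?normc_ge0 // ltW.
move=> K hK; have := hM K hK.
by rewrite ME !normr_complexE -rmorphM -rmorphXn -rmorphM lecR.
Qed.

End ComplexSeries.

(** * Exponential sums and the coefficients of the Poincare series *)

Section ExponentialSums.
Variables (n : nat) (f : {mpoly int[n]}).

Definition nb_zero (N : nat) : nat :=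
  #|[pred x : {ffun 'I_n -> 'I_N} | (N%:Z %| eval_res f x)%Z]|.

Lemma sum_expz_eval (C : numClosedFieldType) (N M : nat) (z : C) :
  M.-primitive_root z ->
  \sum_(k < M) \sum_(x : {ffun 'I_n -> 'I_N}) (z ^+ k) ^ eval_res f x =
  M%:R * #|[pred x : {ffun 'I_n -> 'I_N} | (M%:Z %| eval_res f x)%Z]|%:R.
Proof.
move=> z_prim; rewrite exchange_big /=.
under eq_bigr => x _ do rewrite (sum_prim_root _ z_prim).
by rewrite -big_mkcond /= sumr_const mulr_natr.
Qed.

Lemma sum_ord_dvd (V : nmodType) (p M : nat) (F : nat -> V) : (0 < p)%N ->
  \sum_(k < p * M | (p %| k)%N) F k = \sum_(j < M) F (p * j)%N.
Proof.
move=> p_gt0.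
have lt_h (j : 'I_M) : (p * j < p * M)%N by rewrite ltn_pmul2l.
have lt_h' (k : 'I_(p * M)) : (k %/ p < M)%N by rewrite ltn_divLR // (mulnC M).
rewrite (reindex_onto (fun j => Ordinal (lt_h j)) (fun k => Ordinal (lt_h' k))) /=.
  apply: eq_bigl => j; rewrite dvdn_mulr //=; apply/eqP/val_inj.
  by rewrite /= mulKn.
by move=> k pk; apply: val_inj; rewrite /= mulnC divnK.
Qed.

(** From the sum over all k, remove the k divisible by p: there z^k runs over the powers of z^p, a
    primitive M-th root, so these terms count solutions modulo M among the points modulo pM. *)
Lemma sum_expz_eval_coprime (C : numClosedFieldType) (p M : nat) (z : C) :
  (0 < p)%N -> (0 < M)%N -> (p * M).-primitive_root z ->
  \sum_(k < p * M | ~~ (p %| k)%N)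
     \sum_(x : {ffun 'I_n -> 'I_(p * M)}) (z ^+ k) ^ eval_res f x =
  (p * M)%:R * (nb_zero (p * M))%:R - M%:R * (p%:R ^+ n * (nb_zero M)%:R).
Proof.
move=> p_gt0 M_gt0 z_prim.
have zp_prim : M.-primitive_root (z ^+ p).
  by have := dvdn_prim_root z_prim (dvdn_mull p (dvdnn M)); rewrite mulnK.
pose S (y : C) := \sum_(x : {ffun 'I_n -> 'I_(p * M)}) y ^ eval_res f x.
have := sum_expz_eval (p * M) z_prim.
rewrite (bigID (fun k : 'I_(p * M) => p %| k)%N) /=.
rewrite (sum_ord_dvd M (fun k => S (z ^+ k))) //.
rewrite (eq_bigr (fun j : 'I_M => S ((z ^+ p) ^+ j))) => [|j _]; last first.
  by rewrite exprM.
rewrite sum_expz_eval // card_lift_sol // [(p ^ n * _)%:R]natrM natrX.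
by move=> /(canRL (addKr _)) ->; rewrite addrC.
Qed.

Variable R : realType.

(** This is [sum_expz_eval_coprime] for M = p^m, divided by (p^(m+1))^(n+1). *)
Lemma poincare_diffE (p m : nat) (z : R[i]) : prime p ->
  (p ^ m.+1).-primitive_root z ->
  ratr (poincare f p m.+1 - poincare f p m / p%:R) =
  (p ^ m.+1)%:R^-1 * \sum_(k < p ^ m.+1 | ~~ (p %| k)%N)
     (((p ^ m.+1)%:R ^+ n)^-1 *
      \sum_(x : {ffun 'I_n -> 'I_(p ^ m.+1)}) (z ^+ k) ^ eval_res f x).
Proof.
move=> p_prime; rewrite -mulr_sumr; have p_gt0 := prime_gt0 p_prime.
rewrite /poincare !expnM.
have -> : nb_sol f p m.+1 = nb_zero (p ^ m.+1) by [].
have -> : nb_sol f p m = nb_zero (p ^ m) by [].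
rewrite expnS => z_prim; have M_gt0 : (0 < p ^ m)%N by rewrite expn_gt0 p_gt0.
move: (p ^ m)%N z_prim M_gt0 => M z_prim M_gt0.
rewrite sum_expz_eval_coprime // rmorphB /= !fmorph_div !rmorph_nat !natrX !natrM exprMn.
by field; rewrite !pnatr_eq0 -!lt0n p_gt0 M_gt0 !expf_neq0 // ?pnatr_eq0 -?lt0n.
Qed.

(** At most p^(m+1) primitive roots occur, which the factor p^-(m+1) compensates. *)
Lemma poincare_diff_le (p m : nat) (B : R) : prime p ->
  (forall z : R[i], (p ^ m.+1).-primitive_root z -> expsum f (p ^ m.+1) z <= B) ->
  Normc.normc (ratr (poincare f p m.+1 - poincare f p m / p%:R) : R[i]) <= B.
Proof.
move=> p_prime B_ge; set N := (p ^ m.+1)%N.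
have N_gt0 : (0 < N)%N by rewrite expn_gt0 prime_gt0.
have [z z_prim] := prim_root_exists R[i] N_gt0.
have zk_prim k : ~~ (p %| k)%N -> N.-primitive_root (z ^+ k).
  by move=> pk; rewrite (prim_root_exp_coprime _ z_prim) coprime_sym coprimeXl // prime_coprime.
have B_ge0 : 0 <= B%:C.
  by rewrite lecR (le_trans _ (B_ge z z_prim)) // normc_ge0.
rewrite -lecR -normr_complexE (poincare_diffE p_prime z_prim) normrM normfV normr_nat.
rewrite ler_pdivrMl ?ltr0n // (le_trans (ler_norm_sum _ _ _)) //.
apply: (@le_trans _ _ (\sum_(k < N) B%:C)); last first.
  by rewrite sumr_const card_ord mulr_natl.
(* As [B] is nonnegative, the terms with p | k may be added on the right. *)
rewrite [leRHS](bigID (fun k : 'I_N => ~~ (p %| k)%N)) /=.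
rewrite -[leLHS]addr0 lerD ?sumr_ge0 //; apply: ler_sum => k pk.
by rewrite normr_complexE lecR; apply: B_ge; exact: zk_prim.
Qed.

End ExponentialSums.

(** * The root -1 of the Bernstein-Sato polynomial *)

Section BernsteinSatoRoot.
Variables (K : fieldType) (n : nat).
Implicit Type f : {mpoly K[n]}.

Lemma mderiv_map_mpoly (S S' : nzRingType) (phi : {rmorphism S -> S'})
    (i : 'I_n) (g : {mpoly S[n]}) :
  map_mpoly phi (mderiv i g) = mderiv i (map_mpoly phi g).
Proof.
apply/mpolyP => m.
by rewrite mcoeff_map_mpoly !mcoeff_mderiv mcoeff_map_mpoly raddfMn.
Qed.

(** The extra factor g keeps the exponent k - 1 out of the power rule. *)
Lemma mul_mderiv_exp (S : comNzRingType) (i : 'I_n) (g : {mpoly S[n]}) k :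
  g * mderiv i (g ^+ k) = k%:R * g ^+ k * mderiv i g.
Proof.
elim: k => [|k IH]; first by rewrite expr0 -mpolyC1 mderivC mulr0 !mul0r.
by rewrite exprS mderivM mulrDr [g * (g * _)]mulrCA IH -natr1; ring.
Qed.

Definition at_m1 : {mpoly {poly K}[n]} -> {mpoly K[n]} :=
  map_mpoly (horner_eval (-1)).

HB.instance Definition _ := GRing.RMorphism.on at_m1.

Lemma at_m1_liftA f : at_m1 (liftA f) = f.
Proof.
by apply/mpolyP => m; rewrite !mcoeff_map_mpoly /= horner_evalE hornerC.
Qed.

Lemma at_m1_cstA b : at_m1 (cstA n b) = mpolyC n b.[-1].
Proof. exact: map_mpolyC. Qed.

(* At sigma = -1 the element (g, k) becomes g f^(-1-k); it is a polynomial h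
   exactly when g = h f^(k+1), and d_i then maps h to its derivative. *)
Definition regular_at_m1 f (u : {mpoly {poly K}[n]} * nat) : Prop :=
  exists h : {mpoly K[n]}, at_m1 u.1 = h * f ^+ u.2.+1.

(** If g = h f^(k+1) at sigma = -1, then f d_i g - (k+1) g d_i f = (d_i h) f^(k+2): the two terms in
    d_i f cancel. *)
Lemma regular_fpow_deriv f i u :
  regular_at_m1 f u -> regular_at_m1 f (fpow_deriv f i u).
Proof.
case: u => g k [h /= gE]; exists (mderiv i h) => /=.
rewrite rmorphD !rmorphM /= at_m1_liftA at_m1_cstA.
rewrite [at_m1 (mderiv i g)]mderiv_map_mpoly [at_m1 (mderiv i (liftA f))]mderiv_map_mpoly.
rewrite -!/(at_m1 _) at_m1_liftA gE mderivM mulrDr [f * (h * _)]mulrCA.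
rewrite mul_mderiv_exp hornerXsubC -opprD mpolyCN [1 + _]addrC natr1 mpolyC_nat.
by rewrite !exprS; ring.
Qed.

Lemma regular_fpow_derivm f a : regular_at_m1 f (fpow_derivm f a (liftA f, 0%N)).
Proof.
rewrite /fpow_derivm; elim: (enum 'I_n) => /= [|i r IH].
  (* At sigma = -1, f^(sigma+1) is the polynomial 1. *)
  by exists 1; rewrite at_m1_liftA mul1r.
by elim: (a i) => //= k; exact: regular_fpow_deriv.
Qed.

(** Setting sigma = -1 is defined on polynomials, not on their fractions, so f^M first clears
    denominators. The exponent is M + 1 because f^sigma itself becomes 1/f; h is the value of D
    f^(sigma+1). *)
Lemma weyl_act_regular f D : f != 0 ->
  exists M G (h : {mpoly K[n]}), [/\ weyl_act f D (liftA f, 0%N) * FracField.tofrac (liftA f) ^+ M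
                      = FracField.tofrac G & at_m1 G = h * f ^+ M.+1].
Proof.
move=> f_neq0.
have F_neq0 : FracField.tofrac (liftA f) != 0.
  by rewrite tofrac_eq0; apply: contra_neq f_neq0 => F0; rewrite -[f]at_m1_liftA F0 rmorph0.
rewrite /weyl_act; elim/big_ind: _ => [|x y|a _].
- by exists 0%N, 0, 0; rewrite mul0r tofrac0 rmorph0 mul0r.
- move=> [M1 [G1 [h1 [E1 S1]]]] [M2 [G2 [h2 [E2 S2]]]].
  exists (M1 + M2)%N, (G1 * liftA f ^+ M2 + G2 * liftA f ^+ M1), (h1 + h2).
  rewrite tofracD !tofracM !tofracXn -E1 -E2 rmorphD !rmorphM !rmorphXn /=.
  by rewrite at_m1_liftA S1 S2 !exprS !exprD; split; ring.
have [h Sg] := regular_fpow_derivm f a.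
case: (fpow_derivm _ _ _) Sg => g k /= Sg.
exists k, (mcoeff a D * g), (at_m1 (mcoeff a D) * h).
rewrite tofracM rmorphM /= Sg mulrA; split=> //.
by rewrite /fpow_coef /= mulrA mulfVK // expf_neq0.
Qed.

Lemma root_bernstein_sato_m1 f b :
  (1 < mmeasure mdeg f)%N -> is_bernstein_sato f b -> root b (-1).
Proof.
move=> f_gt1 [_ [D bsD] _].
have f_neq0 : f != 0 by apply: contraTneq f_gt1 => ->; rewrite mmeasure0.
have [M [G [h [E S]]]] := weyl_act_regular D f_neq0.
move: E; rewrite bsD -tofracXn -tofracM => /eqP; rewrite tofrac_eq => /eqP GE.
move: S; rewrite -GE rmorphM rmorphXn /= at_m1_liftA at_m1_cstA exprS mulrA.
move/(mulIf (expf_neq0 _ f_neq0)) => bE; apply/rootP/eqP.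
apply: contraTT f_gt1 => b_neq0.
have h_neq0 : h != 0.
  by apply: contra_neq b_neq0 => h0; apply/eqP; rewrite -(mpolyC_eq0 n) bE h0 mul0r.
(* [mmeasure mdeg] is the degree plus one: a nonzero constant has 1, but h f has at least that of f,
   which exceeds 1. *)
have := congr1 (mmeasure mdeg) bE; rewrite msizeC b_neq0 msizeM // -leqNgt.
move: h_neq0; rewrite -(mmeasure_poly_eq0 mdeg) -lt0n.
by case: (mmeasure mdeg h) => // a _ /= ->; exact: leq_addl.
Qed.

End BernsteinSatoRoot.

(** * Location of the poles, and the theorem *)

Lemma normc_cpow (R : realType) (a : R) (z : R[i]) : 0 < a ->
  Normc.normc (cpow a z) = a `^ complex.Re z.
Proof.
case: z => x y a_gt0; rewrite /cpow /expC Normc.normcM /= !mulr0 subr0 add0r.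
rewrite cos2Dsin2 sqrtr1 mulr1 expr0n /= addr0 sqrtr_sqr ger0_norm ?expR_ge0 //.
by rewrite /powR gt_eqF.
Qed.

(** Cauchy product of B with (1 - aX) P; the [match] supplies 0 for the missing coefficient of order
    -1. *)
Lemma is_expansion_diff (F : fieldType) (A B : {poly F}) (P : nat -> F) (a : F) k :
  is_expansion A B P ->
  \sum_(i < k.+1) B`_i *
     (P (k - i)%N - (if (k - i)%N is j.+1 then P j * a else 0)) =
  ((1 - a *: 'X) * A)`_k.
Proof.
case=> _ BP; rewrite mulrBl mul1r -scalerAl coefB coefZ coefXM.
under eq_bigr => i _ do rewrite mulrBr.
rewrite sumrB BP; congr (_ - _); case: k => [|k] /=.
  by rewrite big_ord1 !mulr0.
rewrite big_ord_recr /= subnn mulr0 addr0 -BP mulr_sumr; apply: eq_bigr => i _.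
by rewrite subSn ?leq_ord // mulrA mulrC.
Qed.

(** Since |T0| r < 1, T0 is a root of (1 - T/p) A; coprimality with B excludes A. *)
Lemma pole_poincareE (R : realType) (n : nat) (f : {mpoly int[n]}) (p : nat)
    (T0 : R[i]) (c r : R) :
  prime p -> 0 < r -> Normc.normc T0 * r < 1 ->
  (forall m (z : R[i]), (p ^ m.+1).-primitive_root z ->
     expsum f (p ^ m.+1) z <= c * r ^+ m.+1) ->
  is_pole (poincare f p) T0 -> T0 = p%:R.
Proof.
move=> p_prime r_gt0 T0_lt bound [A [B [AB cop BT0]]].
pose g k : rat := poincare f p k -
  (if k is j.+1 then poincare f p j * p%:R^-1 else 0).
pose h := (1 - (p%:R : rat)^-1 *: 'X) * A.
have hT0 : root (map_poly ratr h : {poly R[i]}) T0.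
  apply: (@convolution_root _ (map_poly ratr B) _ (fun k => ratr (g k)) c r) => //.
    move=> k; rewrite coef_map /= -(is_expansion_diff _ _ AB) rmorph_sum /=.
    by apply: eq_bigr => i _; rewrite coef_map rmorphM.
  by move=> k; apply: poincare_diff_le => // z; exact: bound.
have AT0 : (map_poly ratr A : {poly R[i]}).[T0] != 0.
  by apply: coprimep_root BT0; rewrite coprimep_map coprimep_sym.
have p_neq0 : p%:R != 0 :> R[i] by rewrite pnatr_eq0 -lt0n prime_gt0.
move: hT0; rewrite /h rmorphM rootM => /orP[|/rootP/eqP]; last first.
  by rewrite (negPf AT0).
rewrite rmorphB /= rmorph1 map_polyZ /= map_polyX fmorphV rmorph_nat rootE !hornerE.
by rewrite subr_eq0 => /eqP/(congr1 ( *%R p%:R)); rewrite mulr1 mulrA divff // mul1r.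
Qed.

Lemma msize_mpolyZC (R : realType) (n : nat) (f : {mpoly int[n]}) :
  mmeasure mdeg (mpolyZC R f) = mmeasure mdeg f.
Proof.
by rewrite /mpoly.mmeasure; apply: perm_big; apply: msupp_map_mpoly; exact: intr_inj.
Qed.

Theorem proposition2p3 (R : realType) (n d s : nat) (f : {mpoly int[n]})
    (n_ge1 : (1 <= n)%N) (d_gt1 : (1 < d)%N)
    (deg_f : mmeasure mdeg f = d.+1)
    (dim_s : has_dim
       (critical_locus (mpolyZC R (pihomog mdeg d f))) s)
    (bound : forall eps : R, 0 < eps ->
       exists c : R, forall (N : nat) (xi : R[i]),
         (1 <= N)%N -> N.-primitive_root xi ->
         expsum f N xi <= c * N%:R `^ (- ((n%:R - s%:R) / d%:R) + eps))
    (p : nat) (p_prime : prime p)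
    (T0 : R[i]) (pole_T0 : is_pole (poincare f p) T0)
    (s0 : R[i]) (s0_T0 : cpow p%:R (- s0) = T0)
    (t0 : R) (t0_s0 : t0 = complex.Re s0)
    (t0_gt : - ((n%:R - s%:R) / d%:R) < t0) :
  t0 = -1 /\
  (forall b : {poly R[i]}, is_bernstein_sato (mpolyZC R f) b -> root b t0%:C).
Proof.
have p_gt1 : 1 < p%:R :> R by rewrite ltr1n prime_gt1.
have p_gt0 : 0 < p%:R :> R := lt_trans ltr01 p_gt1.
have T0_norm : Normc.normc T0 = p%:R `^ - t0.
  by rewrite -s0_T0 normc_cpow // t0_s0; case: (s0).
suff t0E : t0 = -1.
  split=> // b bs; rewrite t0E rmorphN1; apply: root_bernstein_sato_m1 bs.
  by rewrite msize_mpolyZC deg_f ltnS (ltn_trans _ d_gt1).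
set e := - ((n%:R - s%:R) / d%:R) in bound t0_gt.
(* Half the gap, so that |T0| p^(e+eps) = p^(-eps) < 1. *)
pose eps := (t0 - e) / 2.
have eps_gt0 : 0 < eps by rewrite divr_gt0 // subr_gt0.
have [c c_bound] := bound _ eps_gt0.
have T0E : T0 = p%:R.
  apply: (@pole_poincareE _ _ f p T0 c (p%:R `^ (e + eps))) => //.
  - exact: powR_gt0.
  - rewrite T0_norm -powRD; last by rewrite (gt_eqF p_gt0) implybT.
    have -> : - t0 + (e + eps) = - eps by rewrite /eps; field.
    by rewrite /powR gt_eqF // expR_lt1 mulNr oppr_lt0 mulr_gt0 // ln_gt0.
  move=> m z z_prim; apply: (le_trans (c_bound _ _ _ z_prim)).
    by rewrite expn_gt0 prime_gt0.
  by rewrite natrX -!powR_mulrn ?powR_ge0 ?(ltW p_gt0) // -!powRrM [m.+1%:R * _]mulrC.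
have lnp : ln (p%:R : R) != 0 by rewrite gt_eqF // ln_gt0.
(* Both sides are |T0|; logarithms then give 1 = -t0. *)
have : p%:R = p%:R `^ - t0 :> R.
  by apply: (@complexI R); rewrite -T0_norm T0E -normr_complexE normr_nat rmorph_nat.
move/(congr1 (@ln R)); rewrite ln_powR -{1}[ln _]mul1r => /(mulIf lnp) ->.
by rewrite opprK.
Qed.
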